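(* Let $n\geq 5$ be an integer and let $\lambda$ be an integer with $(n+1)/3\leq\lambda\leq n-3$ such that $n-\lambda$ is odd. There exists an indecomposable $1$-factorization of $\lambda K_{2n}$ which is not simple.
   Context: The complete multigraph $\lambda K_{2n}$ has $2n$ vertices, and each pair of distinct vertices is joined by exactly $\lambda$ edges. A $1$-factor of $\lambda K_{2n}$ is a spanning subgraph consisting of $n$ pairwise independent edges (a perfect matching); two $1$-factors are regarded as equal if they consist of the same unordered pairs of vertices. A $1$-factorization of $\lambda K_{2n}$ is a partition of the edge-(multi)set of $\lambda K_{2n}$ into $1$-factors, i.e. a multiset of $1$-factors such that every pair of distinct vertices is covered exactly $\lambda$ times, counting multiplicities. A $1$-factorization is simple if no $1$-factor is repeated in it. It is decomposable if it is the (multiset) union of a $1$-factorization of $\lambda_0K_{2n}$ and a $1$-factorization of $(\lambda-\lambda_0)K_{2n}$ for some integer $\lambda_0$ with $1\le\lambda_0<\lambda$; otherwise it is indecomposable. *)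

(* Defs.v *)
From mathcomp Require Import all_boot.

Set Implicit Arguments.
Unset Strict Implicit.
Unset Printing Implicit Defensive.

(* A 1-factor is identified with its set of edges, an edge being the unordered
   pair of its ends; so equality of 1-factors is Leibniz equality. *)
Definition one_factor (V : finType) (f : {set {set V}}) : bool :=
  partition f [set: V] && [forall e in f, #|e| == 2].

(* Multisets of 1-factors are sequences considered up to [perm_eq]: the
   multiplicity of f in F is [count_mem f F], and multiset union is [++]. *)
Definition one_factorization (n lambda : nat)
    (F : seq {set {set 'I_(2 * n)}}) : Prop :=
  (forall f, f \in F -> one_factor f) /\
  (forall x y : 'I_(2 * n), x != y ->
     count (fun f : {set {set 'I_(2 * n)}} => [set x; y] \in f) F = lambda).

Definition simple_factorization (n : nat)
    (F : seq {set {set 'I_(2 * n)}}) : Prop := uniq F.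

Definition decomposable (n lambda : nat)
    (F : seq {set {set 'I_(2 * n)}}) : Prop :=
  exists (lambda0 : nat) (F1 F2 : seq {set {set 'I_(2 * n)}}),
    [/\ 1 <= lambda0 < lambda,
        one_factorization lambda0 F1,
        one_factorization (lambda - lambda0) F2 &
        perm_eq F (F1 ++ F2)].

(* Main.v *)
Require Import Defs.
From mathcomp Require Import all_boot.
From mathcomp Require Import all_fingroup all_algebra.
From mathcomp Require Import ring zify.

Set Implicit Arguments.
Unset Strict Implicit.
Unset Printing Implicit Defensive.

Import GRing.Theory.

(** The vertices are two copies of Z_n, written a_x and b_x with x in Z_n.  Some
    1-factors come from a permutation s of Z_n and consist of the crossing edges
    a_x b_(s x); the others, one for each i in Z_n, are the orbits of the
    reflection x |-> i - x acting on each copy, where a fixed point x (so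
    2x = i) contributes the edge a_x b_x instead.  Whatever the parity of n, the
    n reflection factors cover each edge inside a copy once, and each edge
    a_x b_x once.  Taken lambda times, they leave the edges a_x b_(x+d) with
    d <> 0, which the translations x |-> x + d cover.

    This 1-factorization is full of decomposable parts; the point is to perturb
    it.  Write S for the translation by 2.  Colour Z_n with exactly lambda + 2
    colours so that consecutive elements get different colours, and regard the
    colour of x as the colour of the transposition (x-1 x).  For a colour k, the
    product of the transpositions of colour k is an involution t_k, and S t_k
    sends x to x+1 if x has colour k, to x+3 if x+1 has colour k, and to x+2
    otherwise.  Each edge a_x b_(x+1) or a_x b_(x+3) lies in exactly one of these
    lambda + 2 twisted factors, and each edge a_x b_(x+2) in exactly lambda of
    them: all colours except those of x and x+1.  So the twisted factors cover
    the same edges as lambda copies of the translation by 2 together with one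
    copy of each of the translations by 1 and by 3, and can replace them
    ([count_twist], [one_factorization_twisted_family]).

    The result is indecomposable.  If x has colour k, the edge a_x b_(x+1) lies
    only in the lambda - 1 copies of the translation by 1 and in the k-th twisted
    factor.  Hence in a part which factors lambda0 K_2n, all twisted factors have
    the same multiplicity, namely lambda0 minus that of the translation by 1.
    The edge a_0 b_2 lies only in lambda of the twisted factors, so lambda
    divides lambda0 ([indecomposable_of_hub]).  The reflection factors occur
    lambda > 1 times, so the 1-factorization is not simple. *)

(** * Perfect matchings from involutions *)

(** Transporting the involution along [p] lets all computations take place on
    the structured type [T], whatever the numbering of the vertices. *)
Definition factor_of (T V : finType) (p : T -> V) (h : T -> T) : {set {set V}} :=
  [set [set p t; p (h t)] | t : T].

Lemma mem_factor_of (T V : finType) (p : T -> V) (h : T -> T) (x y : T) :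
  injective p -> involutive h -> x != y ->
  ([set p x; p y] \in factor_of p h) = (h x == y).
Proof.
move=> pI hK nxy; apply/imsetP/eqP=> [[t _ E]|<-]; last by exists x.
have: p x \in [set p t; p (h t)] by rewrite -E set21.
have: p y \in [set p t; p (h t)] by rewrite -E set22.
rewrite !inE !(inj_eq pI) => /orP[]/eqP ey /orP[]/eqP ex; subst => //.
- by rewrite eqxx in nxy.
- by rewrite eqxx in nxy.
Qed.

Lemma one_factor_of (T V : finType) (p : T -> V) (h : T -> T) :
  bijective p -> involutive h -> (forall t, h t != t) ->
  one_factor (factor_of p h).
Proof.
move=> pB hK hN; have pI := bij_inj pB; case: pB => q pK qK.
apply/andP; split; last first.
  apply/forall_inP => _ /imsetP[t _ ->].
  by rewrite cards2 (inj_eq pI) (eq_sym t) hN.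
apply/and3P; split.
- apply/eqP/setP => v; rewrite inE; apply/bigcupP.
  exists [set p (q v); p (h (q v))]; first by apply/imsetP; exists (q v).
  by rewrite qK set21.
- apply/trivIsetP => _ _ /imsetP[t _ ->] /imsetP[u _ ->].
  apply: contraNT => /pred0Pn[v] /=; rewrite !inE.
  case/andP=> /orP[]/eqP-> /orP[]/eqP /pI E.
  + by rewrite E.
  + by rewrite E hK setUC.
  + by rewrite -E hK setUC.
  + by move/(inv_inj hK): E ->.
- apply/imsetP => -[t _ /setP /(_ (p t))].
  by rewrite !inE eqxx.
Qed.

(** * A criterion for indecomposability *)

Lemma count_mem_sum (T : eqType) (s r : seq T) :
  uniq s -> count (fun g => g \in s) r = \sum_(g <- s) count_mem g r.
Proof.
elim: s => [|g s IH] /=; first by rewrite big_nil => _; elim: r.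
case/andP=> gs us; rewrite big_cons -IH //.
rewrite -count_predUI [X in _ + X](_ : _ = 0) ?addn0; last first.
  apply/eqP; rewrite -leqn0 leqNgt -has_count; apply/hasPn => h _ /=.
  by apply/andP => -[/eqP-> ]; apply/negP.
by apply: eq_count => h; rewrite /= inE.
Qed.

(** Each edge in the last hypothesis links the multiplicity of one member of [G]
    in a part to that of the common factor [f], so these multiplicities all equal
    one number [k]; counting the hub edge then gives [lambda0 = lambda * k]. *)
Lemma indecomposable_of_hub (n lambda : nat) (F : seq {set {set 'I_(2 * n)}})
    (f : {set {set 'I_(2 * n)}}) (G : seq {set {set 'I_(2 * n)}})
    (x0 y0 : 'I_(2 * n)) :
  uniq G -> size G = lambda -> f \notin G -> x0 != y0 ->
  (forall h, h \in F -> ([set x0; y0] \in h) = (h \in G)) ->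
  (forall g, g \in G -> exists x y : 'I_(2 * n), x != y /\
     forall h, h \in F -> ([set x; y] \in h) = (h \in [:: f; g])) ->
  ~ decomposable lambda F.
Proof.
move=> uG sG fG nxy0 e0 eG [l0 [F1 [F2 [/andP[l0gt l0lt] [_ cF1] _ pF]]]].
have sF h : h \in F1 -> h \in F by move=> hF; rewrite (perm_mem pF) mem_cat hF.
have EG g : g \in G -> count_mem g F1 = l0 - count_mem f F1.
  move=> gG; have [x [y [nxy exy]]] := eG _ gG.
  have ufg : uniq [:: f; g].
    by rewrite /= inE andbT; apply: contraNneq fG => ->.
  have -> : l0 = count (fun h => h \in [:: f; g]) F1.
    by rewrite -(cF1 _ _ nxy); apply: eq_in_count => h /sF; exact: exy.
  by rewrite count_mem_sum // big_cons big_seq1 addKn.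
have := cF1 _ _ nxy0.
rewrite (@eq_in_count _ _ (fun h => h \in G)); last by move=> h /sF; exact: e0.
rewrite count_mem_sum // (eq_big_seq _ EG) big_const_seq count_predT sG.
rewrite iter_addn_0; case: (l0 - _) => [|k] E; first by move: E l0gt; lia.
by move: l0lt; rewrite -E mulSn ltnNge leq_addr.
Qed.

Local Open Scope ring_scope.

(** * The reflection, translation and twisted factors *)

(** The first components are added in Z_n with n = m + 4, so that 0, 1, 2, 3 are
    distinct; the boolean tells the copy, [false] for a and [true] for b. *)
Definition reflect_fun (m : nat) (i : 'I_m.+4) (t : 'I_m.+4 * bool) :=
  if t.1 + t.1 == i then (t.1, ~~ t.2) else (i - t.1, t.2).

Lemma reflect_funK m i : involutive (@reflect_fun m i).
Proof.
move=> [x s]; rewrite /reflect_fun /=.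
case: (eqVneq (x + x) i) => /= [E|ni]; first by rewrite E eqxx negbK.
rewrite ifN; first by congr (_, _); ring.
apply: contraNN ni => /eqP E;
have -> : x + x = i + i - ((i - x) + (i - x)) by ring.
by rewrite E addrK.
Qed.

Lemma reflect_fun_neq m i t : @reflect_fun m i t != t.
Proof.
case: t => x s; rewrite /reflect_fun /=.
case: (eqVneq (x + x) i) => [_|ni]; rewrite xpair_eqE eqxx ?andbT.
  by case: s.
apply: contraNN ni => /eqP E; apply/eqP.
by rewrite -[in X in X + _]E subrK.
Qed.

Definition cross (m : nat) (s : {perm 'I_m.+4}) (t : 'I_m.+4 * bool) :=
  if t.2 then ((s^-1)%g t.1, false) else (s t.1, true).

Lemma crossK m s : involutive (@cross m s).
Proof. by case=> x [] /=; rewrite /cross /= ?permK ?permKV. Qed.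

Lemma cross_neq m s t : @cross m s t != t.
Proof. by case: t => x []; rewrite /cross xpair_eqE andbF. Qed.

Definition shift (m : nat) (d : 'I_m.+4) : {perm 'I_m.+4} := perm (addIr d).

(** The product of the transpositions (x-1 x) over all x of colour [k]; these are
    disjoint when consecutive elements have different colours. *)
Definition twist_fun (m : nat) (c : 'I_m.+4 -> nat) (k : nat) (x : 'I_m.+4) :=
  if c x == k then x - 1 else if c (x + 1) == k then x + 1 else x.

Definition proper_colouring (m : nat) (c : 'I_m.+4 -> nat) :=
  forall x, c x != c (x + 1).

Lemma twist_funK m (c : 'I_m.+4 -> nat) k :
  proper_colouring c -> involutive (twist_fun c k).
Proof.
move=> pc x; rewrite /twist_fun; have := pc x; have := pc (x - 1); rewrite subrK.
case: (eqVneq (c x) k) => [E|nx].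
  by rewrite subrK E => /negbTE-> _; rewrite eqxx.
case: (eqVneq (c (x + 1)) k) => [E|nx1] _ _; first by rewrite E eqxx addrK.
by rewrite (negbTE nx) (negbTE nx1).
Qed.

(** The reason for n >= 4: the twists exchange edges between the translations by
    1, 2 and 3, and must leave the edges a_x b_x alone. *)
Lemma small_neq m :
  [/\ (1 != 0 :> 'I_m.+4), 2%:R != 0 :> 'I_m.+4, 3%:R != 0 :> 'I_m.+4
    & [/\ 1 != 2%:R :> 'I_m.+4, 1 != 3%:R :> 'I_m.+4 & 2%:R != 3%:R :> 'I_m.+4]].
Proof. by do 2!split; rewrite -val_eqE /= ?modn_small. Qed.

Definition twist (m : nat) (c : 'I_m.+4 -> nat) (pc : proper_colouring c)
    (k : nat) : {perm 'I_m.+4} :=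
  (perm (inv_inj (twist_funK k pc)) * shift 2%:R)%g.

Lemma twistE m (c : 'I_m.+4 -> nat) (pc : proper_colouring c) k x :
  twist pc k x = x + (if c x == k then 1
                      else if c (x + 1) == k then 3%:R else 2%:R).
Proof.
rewrite permM !permE /twist_fun; case: eqP => _; first by ring.
by case: eqP => _ //; ring.
Qed.

(** How often the translation by [d] is used.  The edges of the translation by 0
    lie in the reflection factors, and the twisted factors take all copies of the
    translation by 2 and one copy of each of those by 1 and 3. *)
Definition weight (m lambda : nat) (d : 'I_m.+4) : nat :=
  if d \in [:: 0; 2%:R] then 0%N
  else if d \in [:: 1; 3%:R] then lambda.-1 else lambda.

Lemma count_iota_eq (a N : nat) : (a < N)%N -> count (pred1 a) (iota 0 N) = 1%N.
Proof. by move=> aN; rewrite count_uniq_mem ?iota_uniq // mem_iota aN. Qed.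

(** The twisted factors make up exactly for the missing translations: for d = 1
    only the colour of [x] counts, for d = 3 only the colour of [x + 1], and for
    d = 2 all the others. *)
Lemma count_twist (m lambda : nat) (c : 'I_m.+4 -> nat)
    (pc : proper_colouring c) x d :
  (forall y, (c y < lambda.+2)%N) -> (0 < lambda)%N ->
  (weight lambda d + count (fun k => twist pc k x == x + d)%R (iota 0 lambda.+2)
   = if d == 0%R then 0 else lambda)%N.
Proof.
move=> cN l0; have [n10 n20 n30 [n12 n13 n23]] := small_neq m.
under eq_count do rewrite twistE (inj_eq (addrI x)) eq_sym.
have c01 := pc x.
move: (count_iota_eq (cN x)) (count_iota_eq (cN (x + 1))) (size_iota 0 lambda.+2).
generalize (iota 0 lambda.+2) => s cx cx1 szs; rewrite /weight !inE.
case: (eqVneq d 0) => [->|d0] /=.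
  rewrite add0n; apply/eqP; rewrite -leqn0 leqNgt -has_count; apply/hasPn=> k _.
  by rewrite eq_sym; case: ifP => _; last case: ifP.
case: (eqVneq d 2%:R) => [->|d2].
  rewrite (@eq_count _ _ (predC (predU (pred1 (c x)) (pred1 (c (x + 1)))))).
    move: (count_predC (predU (pred1 (c x)) (pred1 (c (x + 1)))) s).
    have := count_predUI (pred1 (c x)) (pred1 (c (x + 1))) s.
    rewrite cx cx1 szs.
    rewrite [count (predI _ _) _](_ : _ = 0%N); first by lia.
    apply/eqP; rewrite -leqn0 leqNgt -has_count; apply/hasPn=> k _ /=.
    by apply/andP => -[/eqP-> /eqP E]; rewrite E eqxx in c01.
  move=> k /=; rewrite ![k == _]eq_sym; case: ifP => _.
    by rewrite eq_sym (negbTE n12).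
  by case: ifP => _; rewrite ?eqxx ?(negbTE n23).
case: (eqVneq d 1) => [->|d1] /=.
  rewrite (@eq_count _ _ (pred1 (c x))) ?cx ?cx1 //; first by lia.
  move=> k /=; rewrite [k == _]eq_sym; case: ifP => // _.
  by case: ifP; rewrite ?(negbTE n12) ?(negbTE n13).
case: (eqVneq d 3%:R) => [->|d3] /=.
  rewrite (@eq_count _ _ (pred1 (c (x + 1)))) ?cx ?cx1 //; first by lia.
  move=> k /=; rewrite [k == _]eq_sym; case: (eqVneq (c x) k) => [<-|nk].
    by rewrite [3%:R == _]eq_sym (negbTE n13) eq_sym (negbTE c01).
  by case: ifP; rewrite ?eqxx // [3%:R == _]eq_sym (negbTE n23).
rewrite (@eq_count _ _ pred0) ?count_pred0 ?addn0 // => k /=.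
by case: ifP => _; [|case: ifP => _]; apply/negbTE.
Qed.

(** * The 1-factorization *)

Lemma count_blocks (I : finType) (T : Type) (P : pred T) (g : I -> T)
    (w : I -> nat) :
  count P (flatten [seq nseq (w i) (g i) | i <- enum I])
    = (\sum_i P (g i) * w i)%N.
Proof.
rewrite count_flatten sumnE !big_map -enumT big_enum /=.
by apply: eq_bigr => i _; rewrite count_nseq.
Qed.

Definition twisted_family (m lambda : nat) (c : 'I_m.+4 -> nat)
    (pc : proper_colouring c) (V : finType) (p : 'I_m.+4 * bool -> V) :
    seq {set {set V}} :=
  flatten [seq nseq lambda (factor_of p (reflect_fun i)) | i <- enum 'I_m.+4]
  ++ flatten [seq nseq (weight lambda d) (factor_of p (cross (shift d)))
             | d <- enum 'I_m.+4]
  ++ [seq factor_of p (cross (twist pc k)) | k <- iota 0 lambda.+2].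

Variant twisted_family_spec (m lambda : nat) (c : 'I_m.+4 -> nat)
    (pc : proper_colouring c) (V : finType) (p : 'I_m.+4 * bool -> V) :
    {set {set V}} -> Prop :=
| FamilyReflect i : twisted_family_spec lambda pc p (factor_of p (reflect_fun i))
| FamilyShift d of weight lambda d != 0%N :
    twisted_family_spec lambda pc p (factor_of p (cross (shift d)))
| FamilyTwist k of (k < lambda.+2)%N :
    twisted_family_spec lambda pc p (factor_of p (cross (twist pc k))).

Lemma twisted_familyP (m lambda : nat) (c : 'I_m.+4 -> nat)
    (pc : proper_colouring c) (V : finType) (p : 'I_m.+4 * bool -> V) f :
  f \in twisted_family lambda pc p -> twisted_family_spec lambda pc p f.
Proof.
rewrite !mem_cat => /or3P[/flatten_mapP[i _]|/flatten_mapP[d _]|/mapP[k]].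
- by rewrite mem_nseq => /andP[_ /eqP->]; exact: FamilyReflect.
- by rewrite mem_nseq => /andP[w /eqP->]; apply: FamilyShift; rewrite -lt0n.
- by rewrite mem_iota => kN ->; exact: FamilyTwist.
Qed.

Lemma mem_cross (m : nat) (V : finType) (p : 'I_m.+4 * bool -> V)
    (s : {perm 'I_m.+4}) x y :
  injective p ->
  ([set p (x, false); p (y, true)] \in factor_of p (cross s)) = (s x == y).
Proof.
move=> pI; rewrite mem_factor_of //; first by rewrite xpair_eqE andbT.
  exact: crossK.
by rewrite xpair_eqE andbF.
Qed.

Lemma mem_cross_side (m : nat) (V : finType) (p : 'I_m.+4 * bool -> V)
    (s : {perm 'I_m.+4}) x y b :
  injective p -> x != y ->
  ([set p (x, b); p (y, b)] \in factor_of p (cross s)) = false.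
Proof.
move=> pI nxy; rewrite mem_factor_of //; first by case: b; rewrite xpair_eqE andbF.
  exact: crossK.
by rewrite xpair_eqE eqxx andbT.
Qed.

Lemma mem_reflect (m : nat) (V : finType) (p : 'I_m.+4 * bool -> V) i x y :
  injective p ->
  ([set p (x, false); p (y, true)] \in factor_of p (reflect_fun i))
    = (x == y) && (x + x == i).
Proof.
move=> pI; rewrite mem_factor_of //; first last.
- by rewrite xpair_eqE andbF.
- exact: reflect_funK.
by rewrite /reflect_fun /=; case: ifP; rewrite xpair_eqE ?andbT ?andbF.
Qed.

Lemma mem_reflect_side (m : nat) (V : finType) (p : 'I_m.+4 * bool -> V) i x y b :
  injective p -> x != y ->
  ([set p (x, b); p (y, b)] \in factor_of p (reflect_fun i)) = (x + y == i).
Proof.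
move=> pI nxy; rewrite mem_factor_of //; first last.
- by rewrite xpair_eqE eqxx andbT.
- exact: reflect_funK.
rewrite /reflect_fun /=; case: (eqVneq (x + x) i) => [<-|_].
  by rewrite xpair_eqE (negbTE nxy) (inj_eq (addrI x)) (eq_sym y) (negbTE nxy).
by rewrite xpair_eqE eqxx andbT subr_eq addrC eq_sym.
Qed.

(** The edges inside a copy come from the reflection with [i = x + y] alone; a
    crossing edge a_x b_y comes from the reflections if [x = y], and otherwise
    from the translation by [y - x] and the twisted factors. *)
Lemma one_factorization_twisted_family (m lambda : nat) (c : 'I_m.+4 -> nat)
    (pc : proper_colouring c) (p : 'I_m.+4 * bool -> 'I_(2 * m.+4)) :
  bijective p -> (forall y, (c y < lambda.+2)%N) -> (0 < lambda)%N ->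
  one_factorization lambda (twisted_family lambda pc p).
Proof.
move=> pB cN l0; have pI := bij_inj pB; split.
  move=> _ /twisted_familyP[i|d _|k _]; apply: one_factor_of => //.
  - exact: reflect_funK.
  - exact: reflect_fun_neq.
  - exact: crossK.
  - exact: cross_neq.
  - exact: crossK.
  - exact: cross_neq.
have cross_edge x y :
    count (fun f : {set {set 'I_(2 * m.+4)}} =>
             [set p (x, false); p (y, true)] \in f) (twisted_family lambda pc p)
    = lambda.
  rewrite !count_cat !count_blocks count_map.
  under eq_bigr do rewrite mem_reflect //.
  under [X in (_ + (X + _))%N]eq_bigr do rewrite mem_cross // permE.
  under [X in (_ + (_ + X))%N]eq_count do rewrite /= mem_cross //.
  (* Only the reflection with i = 2x and the translation by y - x contribute. *)
  rewrite (bigD1 (x + x)) //= eqxx andbT big1 ?addn0; last first.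
    by move=> i; rewrite eq_sym => /negbTE->; rewrite andbF.
  rewrite (bigD1 (y - x)) //= addrC subrK eqxx mul1n big1 ?addn0; last first.
    by move=> i; case: (x + i =P y) => // <-; rewrite addrAC subrr add0r eqxx.
  have := count_twist pc x (y - x) cN l0.
  rewrite subr_eq0 [x + _]addrC subrK [y == x]eq_sym => ->.
  by case: eqP => _; rewrite ?mul1n ?mul0n ?addn0 ?add0n.
have side_edge x y b : x != y ->
    count (fun f : {set {set 'I_(2 * m.+4)}} => [set p (x, b); p (y, b)] \in f)
      (twisted_family lambda pc p) = lambda.
  move=> nxy; rewrite !count_cat !count_blocks count_map.
  under eq_bigr do rewrite mem_reflect_side //.
  under [X in (_ + (X + _))%N]eq_bigr do rewrite mem_cross_side //.
  rewrite [X in (_ + (_ + X))%N](@eq_count _ _ pred0); last first.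
    by move=> k; rewrite /= mem_cross_side.
  rewrite [X in (_ + (X + _))%N]big1 // count_pred0 !addn0 (bigD1 (x + y)) //=.
  rewrite eqxx mul1n big1 ?addn0 //.
  by move=> i; rewrite eq_sym => /negbTE->.
have [q pK qK] := pB.
move=> u v; rewrite -(qK u) -(qK v) (inj_eq pI).
case: (q u) (q v) => [x [|]] [y [|]]; rewrite xpair_eqE ?andbT // => nxy.
- exact: side_edge.
- by rewrite -[RHS](cross_edge y x); apply: eq_count => f; rewrite setUC.
- exact: side_edge.
Qed.

(** Every colour has to occur: a twisted factor of an absent colour would be a
    plain translation by 2, with no edge linking it to the translation by 1. *)
Lemma indecomposable_twisted_family (m lambda : nat) (c : 'I_m.+4 -> nat)
    (pc : proper_colouring c) (p : 'I_m.+4 * bool -> 'I_(2 * m.+4)) :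
  bijective p -> (forall y, (c y < lambda.+2)%N) ->
  (forall k, (k < lambda.+2)%N -> exists x, c x = k) -> (0 < lambda)%N ->
  ~ decomposable lambda (twisted_family lambda pc p).
Proof.
move=> pB cN cS l0; have pI := bij_inj pB.
have [n10 n20 n30 [n12 n13 n23]] := small_neq m.
have nxx1 (x : 'I_m.+4) : (x == x + 1) = false.
  by rewrite -[in X in X == _](addr0 x) (inj_eq (addrI x)) eq_sym (negbTE n10).
have edge_shift x : [set p (x, false); p (x + 1, true)]
    \in factor_of p (cross (shift 1)) by rewrite mem_cross // permE.
have edge_twist x k : ([set p (x, false); p (x + 1, true)]
    \in factor_of p (cross (twist pc k))) = (c x == k).
  rewrite mem_cross // twistE (inj_eq (addrI x)); case: ifP => _.
    by rewrite eqxx.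
  by case: ifP; rewrite eq_sym ?(negbTE n12) ?(negbTE n13).
(* The twisted factors through a_0 b_2; [count_twist] shows there are lambda. *)
pose K := [seq k <- iota 0 lambda.+2 | twist pc k 0 == 2%:R].
apply: (@indecomposable_of_hub _ _ _ (factor_of p (cross (shift 1)))
  [seq factor_of p (cross (twist pc k)) | k <- K]
  (p (0, false)) (p (2%:R, true))).
- rewrite map_inj_in_uniq ?filter_uniq ?iota_uniq // => j k.
  rewrite !mem_filter !mem_iota => /andP[_ /= /cS[x <-]] _ E.
  by move: (edge_twist x k); rewrite -E edge_twist eqxx => /esym/eqP.
- rewrite size_map size_filter; have := count_twist pc 0 2%:R cN l0.
  by rewrite /weight !inE eqxx orbT (negbTE n20) add0r.
- apply/mapP => -[k _ E]; move: (edge_shift 0); rewrite E mem_cross //.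
  have : [set p (1, false); p (1 + 1, true)] \in factor_of p (cross (twist pc k)).
    by rewrite -E.
  (* The edges at 0 and 1 would force the consecutive 0 and 1 to share colour k. *)
  move=> e1 e0; have := edge_shift 0; rewrite E edge_twist => /eqP c0.
  move: e1; rewrite edge_twist -c0 => /eqP c1.
  by have := pc 0; rewrite add0r c1 eqxx.
- by rewrite (inj_eq pI) xpair_eqE andbF.
- move=> f /twisted_familyP[i|d w|k kN].
  + rewrite mem_reflect // eq_sym (negbTE n20); apply/esym/negbTE/mapP => -[k].
    rewrite mem_filter => /andP[t2 _] E.
    have : [set p (0, false); p (2%:R, true)] \in factor_of p (reflect_fun i).
      by rewrite E mem_cross.
    by rewrite mem_reflect // eq_sym (negbTE n20).
  + have e0 : [set p (0, false); p (2%:R, true)]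
        \in factor_of p (cross (shift d)) = false.
      rewrite mem_cross // permE add0r; apply: contraNF w => /eqP->.
      by rewrite /weight !inE eqxx orbT.
    rewrite e0; apply/esym/negbTE/mapP => -[k].
    rewrite mem_filter => /andP[t2 _] E; move: e0.
    by rewrite E mem_cross // t2.
  + rewrite mem_cross //; apply/idP/mapP => [t2|[j]].
      by exists k; rewrite // mem_filter t2 mem_iota.
    rewrite mem_filter => /andP[t2 _] E.
    by rewrite -(@mem_cross _ _ p) // E mem_cross.
- move=> g /mapP[k]; rewrite mem_filter mem_iota => /andP[_ /= /cS[x ck]] ->.
  exists (p (x, false)), (p (x + 1, true)); split.
    by rewrite (inj_eq pI) xpair_eqE andbF.
  move=> f fF; apply/idP/idP; last first.
    by rewrite !inE => /orP[]/eqP->; rewrite ?edge_shift // edge_twist ck.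
  case/twisted_familyP: fF => [i|d w|j jN].
  + by rewrite mem_reflect // nxx1.
  + rewrite mem_cross // permE (inj_eq (addrI x)) => /eqP->.
    by rewrite inE eqxx.
  + by rewrite edge_twist ck => /eqP->; rewrite !inE eqxx orbT.
Qed.

Lemma twisted_family_not_uniq (m lambda : nat) (c : 'I_m.+4 -> nat)
    (pc : proper_colouring c) (V : finType) (p : 'I_m.+4 * bool -> V) :
  (1 < lambda)%N -> ~~ uniq (twisted_family lambda pc p).
Proof.
rewrite /twisted_family enum_ordSl /=.
by case: lambda => [|[|l]] //= _; rewrite inE eqxx.
Qed.

Local Close Scope ring_scope.

(** * A colouring of the cycle *)

(** The first lambda + 2 elements get all the colours; the remaining ones
    alternate between 1 and 2.  They start with 1, which differs from the colour
    lambda + 1 before them, and do not use the colour 0 that follows them on the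
    cycle. *)
Definition colour (m lambda : nat) (x : 'I_m.+4) : nat :=
  if x <= lambda.+1 then nat_of_ord x else (odd (x - lambda)).+1.

Lemma val_succ (m : nat) (x : 'I_m.+4) :
  (x + 1)%R = (if x == m.+3 :> nat then 0 else x.+1) :> nat.
Proof.
rewrite /= (modn_small (isT : 1 < m.+4)) addn1; case: eqP => [->|nx].
  exact: modnn.
by rewrite modn_small //; have := ltn_ord x; lia.
Qed.

Lemma colour_proper (m lambda : nat) :
  0 < lambda -> proper_colouring (@colour m lambda).
Proof.
move=> l0 x; rewrite /colour val_succ; have := ltn_ord x.
case: (eqVneq (nat_of_ord x) m.+3) => [->|nx] xm; first by case: ifP.
case: (ltnP x lambda.+1) => [xl|lx]; first by rewrite ltnW //; lia.
case: (leqP x lambda.+1) => xl; last by rewrite subSn /=; [case: odd | lia].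
have -> : nat_of_ord x = lambda.+1 by lia.
by rewrite -addn2 addKn /= eqSS -lt0n.
Qed.

Lemma colour_lt (m lambda : nat) (x : 'I_m.+4) :
  0 < lambda -> colour lambda x < lambda.+2.
Proof. by rewrite /colour; case: ifP => // _; case: odd => /=; lia. Qed.

Lemma colour_surj (m lambda k : nat) :
  lambda.+2 <= m.+4 -> k < lambda.+2 -> exists x : 'I_m.+4, colour lambda x = k.
Proof.
move=> lm kl; exists (Ordinal (leq_trans kl lm)).
by rewrite /colour /= -ltnS kl.
Qed.

Theorem proposition2 (n lambda : nat) (hn : 5 <= n)
    (hlow : n + 1 <= 3 * lambda) (hup : lambda <= n - 3)
    (hodd : odd (n - lambda)) :
  exists F : seq {set {set 'I_(2 * n)}},
    [/\ one_factorization lambda F,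
        ~ decomposable lambda F &
        ~ simple_factorization F].
Proof.
have l2 : 1 < lambda by lia.
have lm : lambda.+2 <= n by lia.
case: n hn {hlow hup hodd} lm => [|[|[|[|m]]]] // _ lm.
have [p pB] : {p : 'I_m.+4 * bool -> 'I_(2 * m.+4) | bijective p}.
  have E : #|{: 'I_m.+4 * bool}| = 2 * m.+4.
    by rewrite card_prod card_bool card_ord mulnC.
  exists (cast_ord E \o enum_rank); apply: bij_comp; last first.
    exact: enum_rank_bij.
  by exists (cast_ord (esym E)); [exact: cast_ordK | exact: cast_ordKV].
have l0 := ltnW l2.
exists (twisted_family lambda (colour_proper l0) p); split.
- by apply: one_factorization_twisted_family => // y; apply: colour_lt.
- apply: indecomposable_twisted_family => // [y|k kl]; first exact: colour_lt.
  exact: colour_surj.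
- by rewrite /simple_factorization (negbTE (twisted_family_not_uniq _ _ l2)).
Qed.
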